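(* Let $E$ be a Banach lattice. The following hold. (i) $\text{r-l-MW}(E)$ is a subalgebra of $\mathrm{L}_r(E)$. Moreover, $\text{r-l-MW}(E)=\mathrm{L}_r(E)$ if and only if the identity operator $I_E$ belongs to $\text{l-MW}(E)$. (ii) If $E$ is Dedekind complete, then $(\text{r-l-MW}(E),\|\cdot\|_{\text{r-l-MW}})$ is a closed Riesz subalgebra and an order ideal of $(\mathrm{L}_r(E),\|\cdot\|_r)$.
   Context: Vector spaces are real and operators are linear. A sequence $(x_n)$ in a Banach lattice is disjoint if $|x_n|\wedge|x_m|=0$ for $n\neq m$. A bounded operator $S:E\to Y$ from a Banach lattice to a Banach space is limitedly MW (l-MW) if $(Sx_n)$ is weakly null for every disjoint bounded sequence $(x_n)$ in $E$. $\text{l-MW}(E)$ is the set of l-MW-operators $E\to E$. An operator $T:E\to E$ is a regularly l-MW-operator, $T\in\text{r-l-MW}(E)$, if $T=T_1-T_2$ with $T_1,T_2$ positive l-MW-operators. $\mathrm{L}_r(E)$ is the space of regular operators on $E$ (differences of two positive operators), with composition as multiplication, the order $S\le T$ iff $T-S$ is positive, and the regular norm $\|T\|_r=\inf\{\|S\|:\pm T\le S\}$ (equal to $\|\,|T|\,\|$ when $E$ is Dedekind complete). The norm on $\text{r-l-MW}(E)$ is $\|T\|_{\text{r-l-MW}}=\inf\{\|S\|:\pm T\le S\in\text{l-MW}(E)\}$. A Riesz subalgebra is a subalgebra that is also a vector sublattice. *)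

(* Defs.v *)
From HB Require Import structures.
From mathcomp Require Import all_boot all_order all_algebra.
From mathcomp Require Import all_classical all_reals all_analysis.
Set Implicit Arguments.
Unset Strict Implicit.
Unset Printing Implicit Defensive.
Import Order.TTheory GRing.Theory Num.Theory.
Import numFieldNormedType.Exports.
Local Open Scope classical_set_scope.
Local Open Scope ring_scope.

(* The order is a field of the mixin, not an [Order.Lattice] structure:
   a structure extending both [NormedModule] and [Order.POrder] is rejected by
   Hierarchy Builder, because [Num.NumDomain] already lies below both. *)
HB.mixin Record isBanachLattice (R : realType) E
    of CompleteNormedModule R E := {
  vle : E -> E -> Prop;
  vjoin : E -> E -> E;
  vmeet : E -> E -> E;
  vle_refl : forall x, vle x x;
  vle_anti : forall x y, vle x y -> vle y x -> x = y;
  vle_trans : forall y x z, vle x y -> vle y z -> vle x z;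
  vle_joinl : forall x y, vle x (vjoin x y);
  vle_joinr : forall x y, vle y (vjoin x y);
  vjoin_le : forall x y z, vle x z -> vle y z -> vle (vjoin x y) z;
  vmeet_lel : forall x y, vle (vmeet x y) x;
  vmeet_ler : forall x y, vle (vmeet x y) y;
  vle_meet : forall x y z, vle z x -> vle z y -> vle z (vmeet x y);
  vle_add2r : forall z x y : E, vle x y -> vle (x + z) (y + z);
  vle_scale : forall (a : R) (x : E), 0 <= a -> vle 0 x -> vle 0 (a *: x);
  vle_norm : forall x y : E,
    vle (vjoin x (- x)) (vjoin y (- y)) -> `|x| <= `|y|
}.

#[short(type="banachLatticeType")]
HB.structure Definition BanachLattice (R : realType) :=
  {E of CompleteNormedModule R E & isBanachLattice R E}.

(* The lattice modulus; [`|x|] is the norm of [x]. *)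
Definition vabs (R : realType) (E : banachLatticeType R) (x : E) : E :=
  vjoin x (- x).

Section Order.
Variables (T : Type) (le : T -> T -> Prop).

(* [z] is the least upper bound of [A] in the ordered set [(D, le)]. *)
Definition is_sup_in (D A : set T) (z : T) : Prop :=
  [/\ D z, (forall x, A x -> le x z) &
      forall w, D w -> (forall x, A x -> le x w) -> le z w].

Definition is_inf_in (D A : set T) (z : T) : Prop :=
  [/\ D z, (forall x, A x -> le z x) &
      forall w, D w -> (forall x, A x -> le w x) -> le w z].

End Order.

Definition dedekind_complete (R : realType) (E : banachLatticeType R) : Prop :=
  forall A : set E, A !=set0 -> (exists b, forall x, A x -> vle x b) ->
    exists z, is_sup_in (@vle R E) setT A z.

Definition weakly_null (R : realType) (Y : normedModType R) (y : nat -> Y) :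
    Prop :=
  forall f : {linear Y -> R^o}, continuous f -> f (y n) @[n --> \oo] --> (0 : R^o).

Definition disjoint_seq (R : realType) (E : banachLatticeType R)
    (x : nat -> E) : Prop :=
  forall n m, n <> m -> vmeet (vabs (x n)) (vabs (x m)) = 0.

Definition limitedly_MW (R : realType) (E : banachLatticeType R)
    (Y : completeNormedModType R) (S : E -> Y) : Prop :=
  [/\ linear S, bounded_fun_norm S &
      forall x : nat -> E, disjoint_seq x -> bounded_fun x ->
        weakly_null (fun n => S (x n))].

Section Operators.
Variables (R : realType) (E : banachLatticeType R).
Implicit Types (S T U : E -> E) (A : set (E -> E)).

Definition lMW : set (E -> E) := [set T | limitedly_MW T].

Definition positive_op T : Prop :=
  linear T /\ forall x, vle 0 x -> vle 0 (T x).

(* [T - S] is the pointwise difference, from the [lmodType] of functions. *)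
Definition op_le S T : Prop := positive_op (T - S).

Definition Lr : set (E -> E) :=
  [set T | exists T1 T2, [/\ positive_op T1, positive_op T2 & T = T1 - T2]].

Definition rlMW : set (E -> E) :=
  [set T | exists T1 T2, [/\ positive_op T1 /\ lMW T1,
                             positive_op T2 /\ lMW T2 & T = T1 - T2]].

(* Meaningful for bounded [T]; it is only applied below to positive operators,
   which are bounded on a Banach lattice. *)
Definition op_norm T : R := sup [set `|T x| | x in [set x : E | `|x| <= 1]].

(* The [S] below are positive, as [2 S = (S - T) + (S + T)]. *)
Definition reg_norm T : R :=
  inf [set op_norm S | S in [set S | op_le T S /\ op_le (- T) S]].

Definition rlMW_norm T : R :=
  inf [set op_norm S | S in [set S | [/\ op_le T S, op_le (- T) S & lMW S]]].

Definition vector_subspace A : Prop :=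
  A 0 /\ forall (a : R) S T, A S -> A T -> A (a *: S + T).

(* A subalgebra need not contain the identity. *)
Definition subalgebra_of_Lr A : Prop :=
  [/\ A `<=` Lr, vector_subspace A &
      forall S T, A S -> A T -> A (S \o T)].

(* Suprema and infima are those of the ordered vector space [Lr]. *)
Definition sublattice_of_Lr A : Prop :=
  [/\ A `<=` Lr, vector_subspace A &
      forall S T, A S -> A T ->
        (exists2 U, is_sup_in op_le Lr [set S; T] U & A U) /\
        (exists2 U, is_inf_in op_le Lr [set S; T] U & A U)].

Definition Riesz_subalgebra_of_Lr A : Prop :=
  subalgebra_of_Lr A /\ sublattice_of_Lr A.

(* [M] is the modulus of [T] in [Lr]; it is unique, and exists for every [T]
   in [Lr] when [E] is Dedekind complete (Riesz-Kantorovich). *)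
Definition is_modulus T (M : E -> E) : Prop :=
  is_sup_in op_le Lr [set T; - T] M.

Definition order_ideal_of_Lr A : Prop :=
  [/\ A `<=` Lr, vector_subspace A &
      forall S T MS MT, Lr S -> A T ->
        is_modulus S MS -> is_modulus T MT -> op_le MS MT -> A S].

Definition closed_in_Lr A : Prop :=
  forall T, Lr T ->
    (forall e : R, 0 < e -> exists2 S, A S & reg_norm (T - S) < e) -> A T.

End Operators.

Arguments lMW {R} E _.
Arguments Lr {R} E _.
Arguments rlMW {R} E _.

(* Main.v *)
Require Import Defs.
From HB Require Import structures.
From mathcomp Require Import all_boot all_order all_algebra.
From mathcomp Require Import all_classical all_reals all_analysis.
From mathcomp Require Import ring lra.
Set Implicit Arguments.
Unset Strict Implicit.
Unset Printing Implicit Defensive.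
Import Order.TTheory GRing.Theory Num.Theory.
Import numFieldNormedType.Exports.
Local Open Scope classical_set_scope.
Local Open Scope ring_scope.

(** The algebraic half is soft.  A positive operator is bounded
    ([positive_map_bounded]), hence weakly continuous, so [P \o T] is l-MW as
    soon as [P] is positive and [T] is l-MW ([lMW_comp]).  Therefore the r-l-MW
    operators form a left ideal of the regular operators ([rlMW_comp]); a left
    ideal is a subalgebra, and it is everything exactly when it contains the
    identity.

    The order half rests on one domination principle, [lMW_approx]: a positive
    operator [P] is l-MW if for every [e > 0] it lies below [Q + V] for some
    l-MW operator [Q] and some positive [V] of norm at most [e].  Indeed every
    disjoint bounded sequence is a difference of two positive ones, every
    continuous functional is a difference of two positive ones, and for a
    positive functional [g] and positive [x n] the number [g (P (x n))] lies
    between 0 and [g (Q (x n)) + g (V (x n))], where the first term tends to 0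
    and the second is at most a constant times [e].

    With [V = 0] this says that the r-l-MW operators are order convex
    ([rlMW_order_convex]), which gives the ideal property, and also the
    sublattice property once suprema exist: [S1 - S2] and [T1 - T2] are both
    below [S1 + T1], so their supremum lies between two r-l-MW operators.  With
    [V] bounding [T - S] for an r-l-MW operator [S = S1 - S2] close to [T], the
    positive part of [T] is below [S1 + V] and the negative part below
    [S2 + V], which gives closedness.  Finally the modulus of an r-l-MW operator
    is itself l-MW, so it attains both infima that define the two norms.

    The Riesz-Kantorovich construction of positive parts is used twice: for
    operators on a Dedekind complete [E], which provides the suprema, and for
    functionals, with the real line as Dedekind complete target. *)

(** * Positive parts and norms in a Banach lattice *)

Definition vpos (R : realType) (E : banachLatticeType R) (x : E) : E :=
  vjoin x 0.

Section VectorLattice.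
Variables (R : realType) (E : banachLatticeType R).
Implicit Types (a b x y z : E).

Lemma vle_add x y z t : vle x y -> vle z t -> vle (x + z) (y + t).
Proof.
move=> xy zt; apply: (vle_trans (y + z)); first exact: vle_add2r.
by rewrite ![y + _]addrC; apply: vle_add2r.
Qed.

Lemma vle_subr x y : vle 0 (y - x) <-> vle x y.
Proof.
split=> [/(@vle_add2r _ _ x)|/(@vle_add2r _ _ (- x))].
  by rewrite add0r subrK.
by rewrite subrr.
Qed.

Lemma vle_add_ge0 x y : vle 0 x -> vle 0 y -> vle 0 (x + y).
Proof. by move=> x0 y0; rewrite -[0]addr0; apply: vle_add. Qed.

Lemma vle_opp x y : vle x y -> vle (- y) (- x).
Proof. by move/vle_subr => h; apply/vle_subr; rewrite opprK addrC. Qed.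

Lemma vle_scale_mono (c : R) x y : 0 <= c -> vle x y -> vle (c *: x) (c *: y).
Proof.
by move=> c0 /vle_subr h; apply/vle_subr; rewrite -scalerBr; apply: vle_scale.
Qed.

Lemma vle_sublD x y z : vle x (y + z) <-> vle (x - y) z.
Proof.
have e : y + z - x = z - (x - y) by rewrite opprB addrCA addrA.
by split=> /vle_subr h; apply/vle_subr; rewrite ?e // -e.
Qed.

Lemma vle_subrD x y z : vle (x + y) z <-> vle y (z - x).
Proof.
have e : z - (x + y) = z - x - y by rewrite opprD addrA.
by split=> /vle_subr h; apply/vle_subr; rewrite ?e // -e.
Qed.

Lemma vpos_ge0 x : vle 0 (vpos x).
Proof. exact: vle_joinr. Qed.

Lemma vpos_ge x : vle x (vpos x).
Proof. exact: vle_joinl. Qed.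

Lemma vpos_le x y : vle x y -> vle 0 y -> vle (vpos x) y.
Proof. exact: vjoin_le. Qed.

(** Both sides of [x^+ = x + x^-] are joins, so each inequality is checked on
    the two arguments of a join. *)
Lemma vpos_sub x : vpos x - vpos (- x) = x.
Proof.
apply/eqP; rewrite subr_eq; apply/eqP/vle_anti.
  apply: vpos_le; first by rewrite -{1}[x]addr0; exact: (vle_add (vle_refl x) (vpos_ge0 _)).
  by apply/vle_sublD; rewrite sub0r; apply: vpos_ge.
apply/vle_subrD/vpos_le; last exact/vle_subr/vpos_ge.
by apply/vle_subrD; rewrite subrr; apply: vpos_ge0.
Qed.

Lemma vabs_ge x : vle x (vabs x).
Proof. exact: vle_joinl. Qed.

Lemma vabs_geN x : vle (- x) (vabs x).
Proof. exact: vle_joinr. Qed.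

Lemma vabs_le x y : vle x y -> vle (- x) y -> vle (vabs x) y.
Proof. exact: vjoin_le. Qed.

(** Adding [x <= |x|] and [- x <= |x|] gives [0 <= 2 |x|]. *)
Lemma vabs_ge0 x : vle 0 (vabs x).
Proof.
have h : vle 0 (vabs x + vabs x).
  by rewrite -(subrr x); apply: vle_add (vabs_ge x) (vabs_geN x).
rewrite -[vabs x]scale1r (splitr 1) scalerDl -scalerDr.
by apply: vle_scale h; rewrite divr_ge0 // ler0n.
Qed.

Lemma vabs_id x : vle 0 x -> vabs x = x.
Proof.
move=> x0; apply: vle_anti (vabs_ge x); apply: vabs_le; first exact: vle_refl.
by apply: (vle_trans _ _ _ _ x0); rewrite -oppr0; apply: vle_opp.
Qed.

Lemma norm_le_of_vle x y : vle x y -> vle (- x) y -> `|x| <= `|y|.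
Proof.
move=> xy Nxy; apply: vle_norm.
by apply: (vle_trans y); [apply: vabs_le | apply: vle_joinl].
Qed.

Lemma norm_le_ge0 x y : vle 0 x -> vle x y -> `|x| <= `|y|.
Proof.
move=> x0 xy; apply: norm_le_of_vle => //; apply: vle_trans xy.
by apply: (vle_trans _ _ _ _ x0); rewrite -oppr0; apply: vle_opp.
Qed.

Lemma norm_vabs x : `|vabs x| = `|x|.
Proof.
apply/eqP; rewrite eq_le (norm_le_of_vle (vabs_ge x) (vabs_geN x)) andbT.
by apply: vle_norm; rewrite -[vjoin _ _]/(vabs (vabs x)) vabs_id;
  [apply: vle_refl | apply: vabs_ge0].
Qed.

Lemma vpos_le_vabs x : vle (vpos x) (vabs x).
Proof. exact: vpos_le (vabs_ge x) (vabs_ge0 x). Qed.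

Lemma norm_vpos x : `|vpos x| <= `|x|.
Proof.
by rewrite -(norm_vabs x); apply: norm_le_ge0 (vpos_ge0 x) (vpos_le_vabs x).
Qed.

(** The piece below [x] is [z /\ x]; the remainder [z - z /\ x] is below [y]
    because [z - y] is a lower bound of both [z] and [x]. *)
Lemma riesz_decomposition x y z : vle 0 x -> vle 0 y -> vle 0 z ->
  vle z (x + y) ->
  exists z1 z2, [/\ z = z1 + z2, vle 0 z1 /\ vle z1 x & vle 0 z2 /\ vle z2 y].
Proof.
move=> x0 y0 z0 zxy; exists (vmeet z x), (z - vmeet z x); split.
- by rewrite addrC subrK.
- by split; [apply: vle_meet | apply: vmeet_ler].
split; first exact/vle_subr/vmeet_lel.
apply/vle_sublD; rewrite addrC; apply/vle_sublD; apply: vle_meet.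
  by apply/vle_sublD; rewrite -{1}[z]add0r; apply: vle_add y0 (vle_refl z).
by apply/vle_sublD; rewrite addrC.
Qed.

Lemma disjoint_vpos (u : nat -> E) :
  disjoint_seq u -> disjoint_seq (fun n => vpos (u n)).
Proof.
move=> du n m nm; apply: vle_anti; last first.
  by apply: vle_meet; rewrite vabs_id; apply: vpos_ge0.
rewrite -(du n m nm) !(vabs_id (vpos_ge0 _)); apply: vle_meet.
  by apply: vle_trans (vpos_le_vabs _); apply: vmeet_lel.
by apply: vle_trans (vpos_le_vabs _); apply: vmeet_ler.
Qed.

Lemma disjoint_opp (u : nat -> E) :
  disjoint_seq u -> disjoint_seq (fun n => - u n).
Proof.
have vabsN x : vabs (- x) = vabs x.
  by apply: vle_anti; apply: vabs_le; rewrite ?opprK;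
    [apply: vabs_geN|apply: vabs_ge|rewrite -{1}[x]opprK; apply: vabs_geN|apply: vabs_ge].
by move=> du n m nm; rewrite !vabsN; apply: du.
Qed.

(** The positive cone is closed: for [0 <= u n] the negative part of the limit
    [x] is at most [|u n - x|], whose norm tends to 0. *)
Lemma cvg_ge0 (u : nat -> E) x : (\forall n \near \oo, vle 0 (u n)) ->
  u n @[n --> \oo] --> x -> vle 0 x.
Proof.
move=> u0 ux.
suff: vpos (- x) = 0.
  by move=> h; move: (vpos_ge (- x)); rewrite h => /vle_opp; rewrite opprK oppr0.
apply/eqP; rewrite -normr_le0; apply/ler_addgt0Pr => e e0; rewrite add0r.
move/cvgrPdist_lt: ux => /(_ e e0) ux.
near \oo => n.
apply: (@le_trans _ _ `|x - u n|); last by apply: ltW; near: n.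
rewrite distrC -(norm_vabs (u n - x)).
apply: norm_le_ge0 (vpos_ge0 _) _; apply: vpos_le (vabs_ge0 _).
apply: vle_trans (vabs_ge _); rewrite -{1}[- x]add0r.
by apply: vle_add2r; near: n.
Unshelve. all: by end_near. Qed.

End VectorLattice.

(** * Positive linear maps are bounded *)

Section LinearMaps.
Variables (R : realType) (V W : lmodType R) (T : V -> W).
Hypothesis linT : linear T.

Lemma linear_mapB x y : T (x - y) = T x - T y.
Proof. exact: (zmod_morphism_linear linT). Qed.

Lemma linear_map0 : T 0 = 0.
Proof. by rewrite -(subrr 0) linear_mapB subrr. Qed.

Lemma linear_mapN x : T (- x) = - T x.
Proof. by rewrite -sub0r linear_mapB linear_map0 sub0r. Qed.

Lemma linear_mapD x y : T (x + y) = T x + T y.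
Proof. by rewrite -[y]opprK linear_mapB linear_mapN !opprK. Qed.

Lemma linear_mapZ (a : R) x : T (a *: x) = a *: T x.
Proof. by move: (linT a x 0); rewrite !addr0 linear_map0 addr0. Qed.

End LinearMaps.

Definition positive_map (R : realType) (E F : banachLatticeType R)
    (T : E -> F) : Prop :=
  linear T /\ forall x, vle 0 x -> vle 0 (T x).

Section PositiveMaps.
Variables (R : realType) (E F : banachLatticeType R).
Implicit Types (T U W : E -> F).

Lemma positive_map_le T x y : positive_map T -> vle x y -> vle (T x) (T y).
Proof.
by move=> [lT pT] /vle_subr xy; apply/vle_subr; rewrite -linear_mapB //; apply: pT.
Qed.

Lemma norm_positive_map_le T x : positive_map T -> `|T x| <= `|T (vabs x)|.
Proof.
move=> pT; apply: norm_le_of_vle; first exact: (positive_map_le pT (vabs_ge x)).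
by rewrite -linear_mapN; [apply: (positive_map_le pT (vabs_geN x)) | case: pT].
Qed.

(** If [T] were unbounded, there would be positive vectors [u n] of norm
    [2^-n] with [|T (u n)|] at least [2^n].  By completeness they have a sum
    [s]; as [u n <= s] for every [n], the norm of [T s] would be at least
    every [2^n]. *)
Lemma positive_map_bounded T : positive_map T ->
  exists2 K : R, 0 < K & forall x, `|T x| <= K * `|x|.
Proof.
move=> pT; have [lT _] := pT; apply: contrapT => unb.
have exx n : exists x, (4 ^+ n * `|x| < `|T x|)%R.
  apply: contrapT => h; apply: unb; exists (4 ^+ n); first by rewrite exprn_gt0.
  by move=> x; rewrite leNgt; apply/negP => hx; apply: h; exists x.
have [x xP] := choice exx.
have x0 n : 0 < `|x n|.
  rewrite normr_gt0; apply/eqP => x0; move: (xP n).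
  by rewrite x0 (linear_map0 lT) !normr0 mulr0 ltxx.
pose u n := (2 ^+ n * `|x n|)^-1 *: vabs (x n).
have c0 n : 0 <= (2 ^+ n * `|x n|)^-1 by rewrite invr_ge0 mulr_ge0 // exprn_ge0.
have u0 n : vle 0 (u n) by apply: vle_scale => //; apply: vabs_ge0.
have nu n : `|u n| = 2^-1 ^+ n.
  rewrite normrZ ger0_norm // norm_vabs invfM -mulrA mulVf ?mulr1 ?exprVn //.
  by rewrite gt_eqF.
have nTu n : 2 ^+ n <= `|T (u n)|.
  rewrite (linear_mapZ lT) normrZ ger0_norm //.
  apply: (@le_trans _ _ ((2 ^+ n * `|x n|)^-1 * (4 ^+ n * `|x n|))).
    rewrite le_eqVlt; apply/orP; left; apply/eqP.
    have -> : (4 : R) = 2 * 2 by rewrite -natrM.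
    have a0 : (2 : R) ^+ n != 0 by rewrite expf_neq0 // pnatr_eq0.
    have b0 : `|x n| != 0 by rewrite gt_eqF.
    by rewrite exprMn; field; rewrite a0 b0.
  apply: ler_wpM2l => //; apply: ltW; apply: lt_le_trans (xP n) _.
  exact: norm_positive_map_le.
have cu : cvgn (series u).
  apply: normed_cvg.
  rewrite (_ : [normed series u] = series (geometric 1 2^-1)).
    by apply: is_cvg_geometric_series; rewrite ger0_norm ?invr_ge0// invf_lt1 // ltr1n.
  by apply/funext => n; apply: eq_bigr => i _; rewrite /geometric /= nu mul1r.
have us n : vle (u n) (limn (series u)).
  apply/vle_subr.
  apply: (@cvg_ge0 _ _ (fun m => series u m - u n)); last first.
    by apply: cvgB; [exact: cu | exact: cvg_cst].
  exists n.+1 => //= m nm; rewrite /series /= (bigD1_seq n) /= ?iota_uniq //.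
    rewrite [u n + _]addrC addrK; apply: (big_ind (vle 0)) => //;
      [apply: vle_refl | by move=> a b; apply: vle_add_ge0].
  by rewrite mem_index_iota.
have Ts n : 2 ^+ n <= `|T (limn (series u))|.
  apply: le_trans (nTu n) _; have [lT' pos] := pT.
  by apply: norm_le_ge0; [apply: pos | apply: positive_map_le].
have := Num.Theory.archi_boundP (normr_ge0 (T (limn (series u)))).
set k := Num.Def.archi_bound _ => hk.
have k2 : k%:R <= 2 ^+ k :> R by rewrite -natrX ler_nat ltnW // ltn_expl.
by have := lt_le_trans hk (le_trans k2 (Ts k)); rewrite ltxx.
Qed.

End PositiveMaps.

(** * The Riesz-Kantorovich construction *)

Section RieszKantorovich.
Variables (R : realType) (E F : banachLatticeType R).

(** On a difference [p - q] of positive vectors the extension has to be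
    [g p - g q]; additivity of [g] makes this independent of the choice of [p]
    and [q], and linearity follows by choosing convenient decompositions. *)
Lemma cone_extension (g : E -> F) :
  (forall x y, vle 0 x -> vle 0 y -> g (x + y) = g x + g y) ->
  (forall (a : R) x, 0 <= a -> vle 0 x -> g (a *: x) = a *: g x) ->
  exists2 U : E -> F, linear U & forall x, vle 0 x -> U x = g x.
Proof.
move=> gD gZ; pose U x := g (vpos x) - g (vpos (- x)).
have pos := @vpos_ge0 _ E.
have g0 : g 0 = 0.
  have := gZ 0 0 (lexx 0) (vle_refl 0).
  by rewrite !scale0r.
have UB x y : vle 0 x -> vle 0 y -> U (x - y) = g x - g y.
  move=> x0 y0; have e : vpos (x - y) + y = x + vpos (- (x - y)).
    have -> : vpos (x - y) = x - y + vpos (- (x - y)).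
      by apply/eqP; rewrite -subr_eq vpos_sub.
    by rewrite addrAC subrK.
  apply/eqP; rewrite /U subr_eq addrAC eq_sym subr_eq -gD // -gD // eq_sym.
  by rewrite e.
exists U; last first.
  by move=> x x0; have := UB x 0 x0 (vle_refl 0); rewrite g0 !subr0.
move=> a x y.
have e : U (a *: x + y) =
    U (a *: (vpos x - vpos (- x)) + (vpos y - vpos (- y))) by rewrite !vpos_sub.
rewrite {}e; have [a0|/ltW a0] := leP 0 a.
  rewrite scalerBr addrACA -opprD UB; try by apply: vle_add_ge0 => //; apply: vle_scale.
  rewrite !gD ?gZ //; try by apply: vle_scale.
  by rewrite opprD addrACA -scalerBr.
have a0' : 0 <= - a by rewrite oppr_ge0.
(* A negative scalar exchanges the roles of the positive and negative parts. *)
have flip (V : lmodType R) (p q : V) : a *: (p - q) = (- a) *: q - (- a) *: p.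
  by rewrite !scaleNr opprK scalerBr addrC.
rewrite flip addrACA -opprD UB; try by apply: vle_add_ge0 => //; apply: vle_scale.
rewrite !gD ?gZ //; try by apply: vle_scale.
by rewrite opprD addrACA -flip.
Qed.

(** The positive part of [T] is [x |-> sup {T y : 0 <= y <= x}] on the cone.
    Its additivity is the Riesz decomposition property; [cone_extension] then
    makes it a linear map.  Only bounds on the sets [T [0, x]] are assumed, so
    that the lemma applies to regular operators and to continuous functionals
    alike. *)
Lemma riesz_kantorovich (T : E -> F) : linear T -> dedekind_complete F ->
  (forall x, vle 0 x -> exists b, forall y, vle 0 y -> vle y x -> vle (T y) b) ->
  exists U : E -> F, [/\ positive_map U,
    forall x, vle 0 x -> vle (T x) (U x) &
    forall W, positive_map W -> (forall x, vle 0 x -> vle (T x) (W x)) ->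
      forall x, vle 0 x -> vle (U x) (W x)].
Proof.
move=> lT dF Tb.
pose A x : set F := [set T y | y in [set y | vle 0 y /\ vle y x]].
have exg x : exists z, vle 0 x -> is_sup_in (@vle R F) setT (A x) z.
  have [x0|nx0] := pselect (vle 0 x); last by exists 0.
  have [z zP] : exists z, is_sup_in (@vle R F) setT (A x) z; last by exists z.
  apply: dF; first by exists (T 0), 0 => //; split=> //; apply: vle_refl.
  by have [b bP] := Tb x x0; exists b => _ [y [y0 yx] <-]; apply: bP.
have [g gP] := choice exg.
have gub x y : vle 0 y -> vle y x -> vle (T y) (g x).
  move=> y0 yx; have [_ ub _] := gP x (vle_trans _ _ _ y0 yx).
  by apply: ub; exists y.
have glub x b : vle 0 x -> (forall y, vle 0 y -> vle y x -> vle (T y) b) ->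
    vle (g x) b.
  move=> x0 h; have [_ _ lub] := gP x x0.
  by apply: lub => // _ [y [y0 yx] <-]; apply: h.
have gD x y : vle 0 x -> vle 0 y -> g (x + y) = g x + g y.
  move=> x0 y0; have xy0 := vle_add_ge0 x0 y0; apply: vle_anti.
    apply: glub => // z z0 /(riesz_decomposition x0 y0 z0) [z1 [z2 [-> [? ?] [? ?]]]].
    by rewrite (linear_mapD lT); apply: vle_add; apply: gub.
  rewrite [g x + _]addrC; apply/vle_subrD/glub => // z z0 zx.
  apply/vle_subrD; rewrite addrC; apply/vle_subrD.
  apply: glub => // t t0 ty; apply/vle_subrD.
  by rewrite -(linear_mapD lT); apply: gub; [apply: vle_add_ge0 | apply: vle_add].
have gZle (a : R) x : 0 < a -> vle 0 x -> vle (g (a *: x)) (a *: g x).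
  move=> a0 x0; apply: glub; first by apply: vle_scale => //; exact: ltW.
  move=> y y0 yx; rewrite -[y](@scalerKV _ _ a) ?gt_eqF // (linear_mapZ lT).
  apply: vle_scale_mono; first exact: ltW.
  have ia0 : 0 <= a^-1 by rewrite invr_ge0 ltW.
  apply: gub; first exact: vle_scale.
  rewrite -[x](@scalerK _ _ a) ?gt_eqF //; exact: vle_scale_mono.
have g0 : g 0 = 0.
  have h := gD 0 0 (vle_refl 0) (vle_refl 0); rewrite addr0 in h.
  by apply: (addrI (g 0)); rewrite -h addr0.
have gZ (a : R) x : 0 <= a -> vle 0 x -> g (a *: x) = a *: g x.
  rewrite le_eqVlt => /predU1P[<-|a0] x0; first by rewrite !scale0r.
  apply: vle_anti; first exact: gZle.
  have ax0 : vle 0 (a *: x) by apply: vle_scale => //; exact: ltW.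
  have := gZle a^-1 (a *: x); rewrite invr_gt0 scalerK ?gt_eqF // => /(_ a0 ax0).
  by move=> /(vle_scale_mono (ltW a0)); rewrite scalerKV // gt_eqF.
have [U lU Ug] := cone_extension gD gZ.
have Tg x : vle 0 x -> vle (T x) (g x).
  by move=> x0; apply: gub => //; apply: vle_refl.
exists U; split.
- split=> // x x0; rewrite Ug // -(linear_map0 lT).
  by apply: gub => //; apply: vle_refl.
- by move=> x x0; rewrite Ug //; apply: Tg.
move=> W pW TW x x0; rewrite Ug //; apply: glub => // y y0 yx.
by apply: (vle_trans (W y)); [apply: TW | apply: positive_map_le].
Qed.

End RieszKantorovich.

(** * Positive functionals and weak convergence *)

Section RealLine.
Variable R : realType.

(* The scalar field as a one-dimensional Banach lattice: this makes functionals
   a special case of maps between Banach lattices. *)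
Let vleR (x y : R^o) : Prop := (x : R) <= y.
Let vjoinR (x y : R^o) : R^o := Num.max (x : R) y.
Let vmeetR (x y : R^o) : R^o := Num.min (x : R) y.

Let vleR_refl x : vleR x x. Proof. exact: lexx. Qed.
Let vleR_anti x y : vleR x y -> vleR y x -> x = y.
Proof. by move=> xy yx; apply/le_anti/andP; split. Qed.
Let vleR_trans y x z : vleR x y -> vleR y z -> vleR x z.
Proof. exact: le_trans. Qed.
Let vleR_joinl x y : vleR x (vjoinR x y).
Proof. by rewrite /vleR le_max lexx. Qed.
Let vleR_joinr x y : vleR y (vjoinR x y).
Proof. by rewrite /vleR le_max lexx orbT. Qed.
Let vjoinR_le x y z : vleR x z -> vleR y z -> vleR (vjoinR x y) z.
Proof. by rewrite /vleR ge_max => -> ->. Qed.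
Let vmeetR_lel x y : vleR (vmeetR x y) x.
Proof. by rewrite /vleR ge_min lexx. Qed.
Let vmeetR_ler x y : vleR (vmeetR x y) y.
Proof. by rewrite /vleR ge_min lexx orbT. Qed.
Let vleR_meet x y z : vleR z x -> vleR z y -> vleR z (vmeetR x y).
Proof. by rewrite /vleR le_min => -> ->. Qed.
Let vleR_add2r z x y : vleR x y -> vleR (x + z) (y + z).
Proof. by rewrite /vleR lerD2r. Qed.
Let vleR_scale (a : R) (x : R^o) : 0 <= a -> vleR 0 x -> vleR 0 (a *: x).
Proof. exact: mulr_ge0. Qed.
Let vleR_norm x y : vleR (vjoinR x (- x)) (vjoinR y (- y)) -> `|x| <= `|y|.
Proof.
have normE (z : R) : Num.max z (- z) = `|z|.
  by case: ger0P => z0; [apply: max_l | apply: max_r]; lra.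
by rewrite /vleR /vjoinR !normE.
Qed.

HB.instance Definition _ := isBanachLattice.Build R R^o
  vleR_refl vleR_anti vleR_trans vleR_joinl vleR_joinr vjoinR_le
  vmeetR_lel vmeetR_ler vleR_meet vleR_add2r vleR_scale vleR_norm.

End RealLine.

Lemma dedekind_complete_real (R : realType) : dedekind_complete R^o.
Proof.
move=> A A0 [b bP]; exists (sup (A : set R)).
have hs : has_sup (A : set R) by split => //; exists b => x /bP.
split => // [x Ax|w _ wP]; first exact: (ub_le_sup hs.2 Ax).
by apply: ge_sup => // x /wP.
Qed.

Section Functionals.
Variables (R : realType) (E : banachLatticeType R).

Lemma positive_map_continuous (F : banachLatticeType R) (T : {linear E -> F}) :
  positive_map T -> continuous T.
Proof.
move=> pT; have [K K0 hK] := positive_map_bounded pT.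
apply/linear_bounded_continuous/linear_boundedP.
near=> r => x; apply: le_trans (hK x) _; apply: ler_wpM2r; first exact: normr_ge0.
by near: r; apply: nbhs_pinfty_ge; exact: num_real.
Unshelve. all: by end_near. Qed.

(** A continuous functional is order bounded, since [|f y| <= K |x|] for
    [0 <= y <= x]; take [g] to be its positive part and [h = g - f]. *)
Lemma continuous_functional_decomposition (f : {linear E -> R^o}) :
  continuous f -> exists g h : E -> R^o,
    [/\ positive_map g, positive_map h & forall x, f x = g x - h x].
Proof.
move=> /linear_bounded_continuous/linear_boundedP fb.
have [K K0 hK] : exists2 K : R, 0 < K & forall x, `|f x| <= K * `|x|.
  near +oo_R => r; exists r; near: r => //; apply: nbhs_pinfty_gt; exact: num_real.
have lf : linear f by exact: linearP.
have [|g [pg fg _]] := riesz_kantorovich lf (@dedekind_complete_real R).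
  move=> x x0; exists (K * `|x|) => y y0 yx.
  apply: le_trans (ler_norm _) _; apply: le_trans (hK y) _.
  by apply: ler_wpM2l; [exact: ltW | exact: norm_le_ge0].
exists g, (fun x => g x - f x); split => //.
  split; last by move=> x x0; apply/vle_subr/fg.
  have [lg _] := pg => a x y.
  by rewrite lg lf scalerBr opprD addrACA.
by move=> x; rewrite opprB addrC subrK.
Unshelve. all: by end_near. Qed.

(** Every continuous functional is a difference of positive ones, so these
    suffice to test weak convergence. *)
Lemma weakly_null_of_positive (y : nat -> E) :
  (forall g : E -> R^o, positive_map g -> g (y n) @[n --> \oo] --> (0 : R^o)) ->
  weakly_null y.
Proof.
move=> yg f /continuous_functional_decomposition[g [h [pg ph fE]]].
rewrite (_ : (fun n => _) = (fun n => g (y n) - h (y n))); last first.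
  by apply/funext => n; apply: fE.
by rewrite -[0 : R^o]subr0; apply: cvgB; [exact: yg | exact: yg].
Qed.

Lemma weakly_null_positive_map (y : nat -> E) (g : E -> R^o) :
  weakly_null y -> positive_map g -> g (y n) @[n --> \oo] --> (0 : R^o).
Proof.
move=> wy pg; have [lg _] := pg.
pose G := HB.pack_for {linear E -> R^o} g (GRing.isLinear.Build R E R^o _ g lg).
exact: (wy G (@positive_map_continuous _ G pg)).
Qed.

Lemma weakly_null_linear_comb (a : R) (y z : nat -> E) :
  weakly_null y -> weakly_null z -> weakly_null (fun n => a *: y n + z n).
Proof.
move=> wy wz f cf.
rewrite (_ : (fun n => _) = (fun n => a *: f (y n) + f (z n))); last first.
  by apply/funext => n; rewrite linearP.
rewrite -[0 : R^o]addr0 -{1}[0 : R^o](scaler0 _ a).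
by apply: cvgD; [apply: cvgZr; apply: wy | apply: wz].
Qed.

Lemma bounded_fun_seq (x : nat -> E) : bounded_fun x ->
  exists2 M : R, 0 < M & forall n, `|x n| <= M.
Proof.
move=> [r [_ rx]]; exists (`|r| + 1); first by rewrite ltr_wpDl.
by move=> n; apply: rx => //; rewrite ltr_pwDr // ler_norm.
Qed.

Lemma bounded_fun_of_seq (x : nat -> E) (M : R) : (forall n, `|x n| <= M) ->
  bounded_fun x.
Proof.
move=> xM; rewrite /= /bounded_near; near=> r => n _ /=.
apply: le_trans (xM n) _; near: r; apply: nbhs_pinfty_ge; exact: num_real.
Unshelve. all: by end_near. Qed.

End Functionals.

(** * l-MW operators and domination *)

Section Operators.
Variables (R : realType) (E : banachLatticeType R).
Implicit Types (S T U V W P Q : E -> E).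

Lemma linear_add S T : linear S -> linear T -> linear (S + T : E -> E).
Proof.
by move=> lS lT a x y; rewrite !fctE lS lT scalerDr addrACA.
Qed.

Lemma linear_opp S : linear S -> linear (- S : E -> E).
Proof. by move=> lS a x y; rewrite !fctE lS opprD scalerN. Qed.

Lemma linear_scale (a : R) S : linear S -> linear (a *: S : E -> E).
Proof.
by move=> lS b x y; rewrite !fctE lS scalerDr !scalerA mulrC.
Qed.

Lemma linear_sub S T : linear S -> linear T -> linear (S - T : E -> E).
Proof. by move=> lS lT; apply: linear_add => //; apply: linear_opp. Qed.

Lemma op_leP S T : linear S -> linear T ->
  op_le S T <-> forall x, vle 0 x -> vle (S x) (T x).
Proof.
move=> lS lT; split=> [[_ h] x x0|h]; first by apply/vle_subr; apply: h.
by split; [apply: linear_sub | move=> x x0; apply/vle_subr; apply: h].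
Qed.

Lemma op_le_vle S T x : op_le S T -> vle 0 x -> vle (S x) (T x).
Proof. by move=> [_ h] x0; apply/vle_subr; apply: h. Qed.

Lemma positive_op0 : positive_op (0 : E -> E).
Proof.
by split=> [a x y|x _]; [rewrite -[RHS]/(a *: (0 : E) + 0) scaler0 addr0 | apply: vle_refl].
Qed.

Lemma positive_op_add S T : positive_op S -> positive_op T -> positive_op (S + T).
Proof.
move=> [lS pS] [lT pT]; split; first exact: linear_add.
by move=> x x0; apply: vle_add_ge0; [apply: pS | apply: pT].
Qed.

Lemma positive_op_scale (a : R) S : 0 <= a -> positive_op S -> positive_op (a *: S).
Proof.
move=> a0 [lS pS]; split; first exact: linear_scale.
by move=> x x0; apply: vle_scale => //; apply: pS.
Qed.

Lemma positive_op_comp S T : positive_op S -> positive_op T -> positive_op (S \o T).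
Proof.
move=> [lS pS] [lT pT]; split; last by move=> x x0; apply/pS/pT.
by move=> a x y; rewrite /= lT lS.
Qed.

Lemma Lr_linear T : Lr E T -> linear T.
Proof. by move=> [T1 [T2 [[l1 _] [l2 _] ->]]]; apply: linear_sub. Qed.

Lemma Lr_of_positive T : positive_op T -> Lr E T.
Proof. by move=> pT; exists T, 0; split => //; [exact: positive_op0 | rewrite subr0]. Qed.

(** A negative scalar swaps the two terms of a difference, so closure of [C]
    under nonnegative combinations is enough. *)
Lemma cone_difference_subspace (C : set (E -> E)) : C 0 ->
  (forall (a : R) S T, 0 <= a -> C S -> C T -> C (a *: S + T)) ->
  vector_subspace [set T | exists T1 T2, [/\ C T1, C T2 & T = T1 - T2]].
Proof.
move=> C0 Clin; split; first by exists 0, 0; rewrite subr0.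
move=> a _ _ [S1 [S2 [p1 p2 ->]]] [T1 [T2 [q1 q2 ->]]].
have [a0|/ltW a0] := leP 0 a.
  exists (a *: S1 + T1), (a *: S2 + T2); split; try exact: Clin.
  by rewrite scalerBr opprD addrACA.
have a0' : 0 <= - a by rewrite oppr_ge0.
exists (- a *: S2 + T1), (- a *: S1 + T2); split; try exact: Clin.
have -> : a *: (S1 - S2) = - a *: S2 - (- a *: S1).
  by rewrite !scaleNr opprK scalerBr addrC.
by rewrite opprD addrACA.
Qed.

Lemma positive_op_linear_comb (a : R) S T : 0 <= a -> positive_op S -> positive_op T ->
  positive_op (a *: S + T).
Proof.
by move=> a0 pS pT; apply: positive_op_add => //; apply: positive_op_scale.
Qed.

Lemma Lr_subspace : vector_subspace (Lr E).
Proof.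
exact: (cone_difference_subspace positive_op0 positive_op_linear_comb).
Qed.

Lemma subspaceB (A : set (E -> E)) S T : vector_subspace A -> A S -> A T -> A (S - T).
Proof.
by move=> [_ h] AS AT; rewrite addrC -scaleN1r; apply: h.
Qed.

Lemma subspaceD (A : set (E -> E)) S T : vector_subspace A -> A S -> A T -> A (S + T).
Proof. by move=> [_ h] AS AT; rewrite -[S]scale1r; apply: h. Qed.

Lemma subspaceN (A : set (E -> E)) S : vector_subspace A -> A S -> A (- S).
Proof. by move=> sA AS; rewrite -sub0r; apply: subspaceB => //; case: sA. Qed.

Lemma bounded_fun_norm_of_linear_bound T (K : R) : 0 < K ->
  (forall x, `|T x| <= K * `|x|) -> bounded_fun_norm T.
Proof.
move=> K0 hK r; exists (K * r) => x xr; apply: le_trans (hK x) _.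
by rewrite ler_pM2l.
Qed.

Lemma lMW_linear_comb (a : R) S T : lMW E S -> lMW E T -> lMW E (a *: S + T).
Proof.
move=> [lS bS wS] [lT bT wT]; split.
- by apply: linear_add => //; apply: linear_scale.
- move=> r; have [M hM] := bS r; have [N hN] := bT r.
  exists (`|a| * M + N) => x xr; rewrite !fctE; apply: le_trans (ler_normD _ _) _.
  by rewrite normrZ; apply: lerD; [apply: ler_wpM2l => //; apply: hM | apply: hN].
by move=> x dx bx; apply: weakly_null_linear_comb; [exact: wS | exact: wT].
Qed.

Lemma lMW0 : lMW E 0.
Proof.
split.
- by case: positive_op0.
- by move=> r; exists 0 => x _; rewrite -[`|_|]/(`|0 : E|) normr0.
move=> x _ _ f _; rewrite (_ : (fun n => _) = (fun=> 0)); first exact: cvg_cst.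
by apply/funext => n; apply: raddf0.
Qed.

Lemma lMW_subspace : vector_subspace (lMW E).
Proof. by split; [exact: lMW0 | move=> a S T; exact: lMW_linear_comb]. Qed.

(** A positive functional [g] composed with [P] is again a positive, hence
    continuous, functional: testing [P (T (x n))] against [g] is testing
    [T (x n)] against [g \o P]. *)
Lemma lMW_comp P T : positive_op P -> lMW E T -> lMW E (P \o T).
Proof.
move=> pP [lT bT wT]; have [lP posP] := pP.
have [K K0 hK] := @positive_map_bounded _ E E P pP.
split.
- by move=> a x y; rewrite /= lT lP.
- move=> r; have [M hM] := bT r; exists (K * M) => x xr /=.
  by apply: le_trans (hK _) _; rewrite ler_pM2l //; apply: hM.
move=> x dx bx; apply: weakly_null_of_positive => g pg.
apply: (@weakly_null_positive_map _ _ (fun n => T (x n)) (g \o P)); first exact: wT.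
have [lg posg] := pg; split; last by move=> y y0; apply/posg/posP.
by move=> a y z; rewrite /= lP lg.
Qed.

(** Domination up to a small error.  The case of an arbitrary disjoint sequence
    reduces to a positive one because the positive parts and the negative parts
    of its terms again form disjoint bounded sequences. *)
Lemma lMW_approx P : positive_op P ->
  (forall e : R, 0 < e -> exists Q V, [/\ lMW E Q, positive_op V,
     forall x, `|V x| <= e * `|x| & op_le P (Q + V)]) ->
  lMW E P.
Proof.
move=> pP approx; have [lP posP] := pP.
have [K0 K0pos hK0] := @positive_map_bounded _ E E P pP.
split=> //; first exact: bounded_fun_norm_of_linear_bound hK0.
move=> x dx /bounded_fun_seq [M M0 xM].
apply: weakly_null_of_positive => g pg; have [lg posg] := pg.
have pos_case (y : nat -> E) : disjoint_seq y -> (forall n, `|y n| <= M) ->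
    (forall n, vle 0 (y n)) -> g (P (y n)) @[n --> \oo] --> (0 : R^o).
  move=> dy yM y0; have [K Kpos hK] := positive_map_bounded pg.
  apply/cvgrPdist_lt => e e0.
  (* [K] bounds [g] and [M] bounds the sequence, so an error [V] of norm at most
     [d] contributes at most [K * d * M = e / 2]. *)
  pose d := e / 2 / (K * M).
  have d0 : 0 < d by rewrite !divr_gt0 // mulr_gt0.
  have [Q [V [lQ pV Vd PQV]]] := approx d d0.
  have [_ _ wQ] := lQ.
  have := weakly_null_positive_map (wQ y dy (bounded_fun_of_seq yM)) pg.
  move=> /cvgrPdist_lt /(_ (e / 2) (divr_gt0 e0 (ltr0Sn _ 1))).
  apply: filterS => n; rewrite !sub0r !normrN => gQ.
  have gP0 : 0 <= g (P (y n)) by apply/posg/posP.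
  rewrite ger0_norm //.
  have h1 : g (P (y n)) <= g (Q (y n)) + g (V (y n)).
    rewrite -(linear_mapD lg).
    by apply: (positive_map_le pg); exact: (op_le_vle PQV (y0 n)).
  have h2 : g (V (y n)) <= e / 2.
    apply: le_trans (ler_norm _) _; apply: le_trans (hK _) _.
    apply: (@le_trans _ _ (K * (d * M))).
      rewrite ler_pM2l //; apply: le_trans (Vd _) _.
      by rewrite ler_pM2l //; apply: yM.
    rewrite le_eqVlt; apply/orP; left; apply/eqP; rewrite /d; field.
    by rewrite !gt_eqF.
  have h3 := ler_norm (g (Q (y n))).
  by lra.
have split_x n : x n = vpos (x n) - vpos (- x n) by rewrite vpos_sub.
rewrite (_ : (fun n => _) = (fun n => g (P (vpos (x n))) - g (P (vpos (- x n))))); last first.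
  by apply/funext => n; rewrite {1}split_x (linear_mapB lP) (linear_mapB lg).
rewrite -[0 : R^o]subr0; apply: cvgB; apply: pos_case.
- exact: disjoint_vpos.
- by move=> n; apply: le_trans (norm_vpos _) _; apply: xM.
- by move=> n; apply: vpos_ge0.
- exact/disjoint_vpos/disjoint_opp.
- by move=> n; apply: le_trans (norm_vpos _) _; rewrite normrN; apply: xM.
- by move=> n; apply: vpos_ge0.
Qed.

(** The approximation principle with no error term. *)
Lemma lMW_domination P Q : positive_op P -> lMW E Q -> op_le P Q -> lMW E P.
Proof.
move=> pP lQ PQ; apply: lMW_approx => // e e0; exists Q, 0; split => //.
- exact: positive_op0.
- by move=> x; rewrite -[`|_ x|]/(`|0 : E|) normr0 mulr_ge0 // ltW.
by rewrite addr0.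
Qed.

Lemma rlMW_Lr : rlMW E `<=` Lr E.
Proof. by move=> _ [T1 [T2 [[p1 _] [p2 _] ->]]]; exists T1, T2. Qed.

Lemma rlMW_subspace : vector_subspace (rlMW E).
Proof.
apply: (@cone_difference_subspace [set T | positive_op T /\ lMW E T]).
  by split; [exact: positive_op0 | exact: lMW0].
move=> a S T a0 [pS lS] [pT lT].
by split; [exact: positive_op_linear_comb | exact: lMW_linear_comb].
Qed.

Lemma rlMW_of_positive P : positive_op P -> lMW E P -> rlMW E P.
Proof.
move=> pP lP; exists P, 0; split => //; last by rewrite subr0.
by split; [exact: positive_op0 | exact: lMW0].
Qed.

Lemma lMW_of_rlMW T : rlMW E T -> lMW E T.
Proof.
by move=> [T1 [T2 [[_ l1] [_ l2] ->]]]; apply: subspaceB lMW_subspace _ _.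
Qed.

(** The r-l-MW operators absorb regular operators on the left, by expanding
    [(S1 - S2) \o (T1 - T2)] and grouping the terms by sign. *)
Lemma rlMW_comp S T : Lr E S -> rlMW E T -> rlMW E (S \o T).
Proof.
move=> [S1 [S2 [p1 p2 ->]]] [T1 [T2 [[q1 m1] [q2 m2] ->]]].
have pm (A B C D : E -> E) : positive_op A -> positive_op B -> positive_op C ->
    positive_op D -> lMW E B -> lMW E D ->
    positive_op ((A \o B) + (C \o D)) /\ lMW E ((A \o B) + (C \o D)).
  move=> pA pB pC pD lB lD; split.
    by apply: positive_op_add; apply: positive_op_comp.
  by apply: subspaceD lMW_subspace _ _; apply: lMW_comp.
exists ((S1 \o T1) + (S2 \o T2)), ((S1 \o T2) + (S2 \o T1)); split; try exact: pm.
have [[l1 _] [l2 _]] := (p1, p2).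
apply/funext => x; rewrite !fctE /= (linear_mapB l1) (linear_mapB l2).
by rewrite opprB addrACA opprD.
Qed.

End Operators.

(** * Order structure of the r-l-MW operators *)

Section OrderStructure.
Variables (R : realType) (E : banachLatticeType R).
Implicit Types (S T U V W M P Q X : E -> E).

Lemma op_le_trans T S U : op_le S T -> op_le T U -> op_le S U.
Proof.
by move=> ST TU; have := positive_op_add TU ST; rewrite addrA subrK.
Qed.

Lemma op_le_oppl S T : op_le (- S) T <-> op_le (- T) S.
Proof. by rewrite /op_le !opprK addrC. Qed.

(** As [2 S = (S - T) + (S + T)]. *)
Lemma positive_op_of_bounds T S : op_le T S -> op_le (- T) S -> positive_op S.
Proof.
move=> TS NTS; have := positive_op_add TS NTS; rewrite opprK addrACA addNr addr0.
move=> pS; have h : 0 <= 1 / 2 :> R by rewrite divr_ge0.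
by have := positive_op_scale h pS; rewrite scalerDr -scalerDl -splitr scale1r.
Qed.

Lemma op_le_addr S P : positive_op P -> op_le S (S + P).
Proof. by rewrite /op_le addrAC subrr add0r. Qed.

Lemma op_le_subr S P : positive_op P -> op_le (S - P) S.
Proof. by move=> pP; rewrite -{2}(subrK P S); apply: op_le_addr. Qed.

Lemma op_le_add S T U V : op_le S T -> op_le U V -> op_le (S + U) (T + V).
Proof.
by move=> ST UV; rewrite /op_le opprD addrACA; apply: positive_op_add.
Qed.

(** For [T = T1 - T2] the operator [T1 + T2] does it. *)
Lemma Lr_bounded T : Lr E T ->
  exists P, [/\ positive_op P, op_le T P & op_le (- T) P].
Proof.
move=> [T1 [T2 [p1 p2 ->]]]; exists (T1 + T2); split.
- exact: positive_op_add.
- exact: (op_le_trans (op_le_subr T1 p2) (op_le_addr T1 p2)).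
rewrite opprB [T1 + T2]addrC.
exact: (op_le_trans (op_le_subr T2 p1) (op_le_addr T2 p1)).
Qed.

(** The supremum is [S + (T - S)^+], where the positive part is the one given
    by Riesz and Kantorovich. *)
Lemma Lr_sup S T : dedekind_complete E -> Lr E S -> Lr E T ->
  exists U, is_sup_in (@op_le R E) (Lr E) [set S; T] U.
Proof.
move=> dE LS LT; have [lS lT] := (Lr_linear LS, Lr_linear LT).
have lD : linear (T - S) by exact: linear_sub.
have [|P [pP DP Pmin]] := riesz_kantorovich lD dE.
  have [Q [pQ DQ _]] := Lr_bounded (subspaceB (Lr_subspace E) LT LS).
  move=> x x0; exists (Q x) => y y0 yx.
  by apply: vle_trans (op_le_vle DQ y0) _; apply: (@positive_map_le _ E E).
exists (S + P); split.
- by apply: subspaceD (Lr_subspace E) LS _; apply: Lr_of_positive.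
- move=> _ [->|->]; first exact: op_le_addr.
  rewrite /op_le -addrA addrCA -opprB.
  by apply/op_leP => //; case: pP.
move=> W LW Wub.
have pW : positive_op (W - S) by apply: Wub; left.
have WT : op_le T W by apply: Wub; right.
have DW : op_le (T - S) (W - S) by rewrite /op_le opprB addrA subrK.
rewrite /op_le opprD addrA; apply/op_leP; [by case: pP | by case: pW | move=> x x0].
by apply: Pmin => // y y0; apply: op_le_vle.
Qed.

(** The map [X |-> S + T - X] reverses the order and exchanges [S] and [T]. *)
Lemma inf_of_sup S T U : Lr E S -> Lr E T ->
  is_sup_in (@op_le R E) (Lr E) [set S; T] U ->
  is_inf_in (@op_le R E) (Lr E) [set S; T] (S + T - U).
Proof.
move=> LS LT [LU Uub Umin]; have LST := subspaceD (Lr_subspace E) LS LT.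
split; first exact: subspaceB (Lr_subspace E) LST LU.
  move=> _ [->|->].
    have := Uub T (or_intror erefl).
    by rewrite /op_le -addrA opprD addrA subrr add0r opprB.
  have := Uub S (or_introl erefl).
  by rewrite /op_le [S + T]addrC -addrA opprD addrA subrr add0r opprB.
move=> W LW Wlb; have LSTW := subspaceB (Lr_subspace E) LST LW.
rewrite /op_le addrAC; apply: Umin => // _ [->|->].
  by have := Wlb T (or_intror erefl); rewrite /op_le addrAC [S + T]addrC addrK.
by have := Wlb S (or_introl erefl); rewrite /op_le addrAC addrK.
Qed.

(** The positive operator [X - S] is dominated by the l-MW operator [T - S]. *)
Lemma rlMW_order_convex S T X : rlMW E S -> rlMW E T ->
  op_le S X -> op_le X T -> rlMW E X.
Proof.
move=> rS rT SX XT; have [sS sl] := (rlMW_subspace E, lMW_subspace E).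
rewrite -(subrK S X); apply: (subspaceD sS _ rS); apply: rlMW_of_positive => //.
apply: (@lMW_domination _ _ _ (T - S)) => //.
  by apply: subspaceB sl _ _; apply: lMW_of_rlMW.
by rewrite /op_le opprB addrA subrK.
Qed.

(** Writing [S = S1 - S2] and [T = T1 - T2], the r-l-MW operator [S1 + T1] is
    above both, so their supremum lies between [S] and [S1 + T1]. *)
Lemma rlMW_sup S T U : rlMW E S -> rlMW E T ->
  is_sup_in (@op_le R E) (Lr E) [set S; T] U -> rlMW E U.
Proof.
move=> rS rT [LU Uub Umin].
have [S1 [S2 [[pS1 lS1] [pS2 lS2] SE]]] := rS.
have [T1 [T2 [[pT1 lT1] [pT2 lT2] TE]]] := rT.
have pW := positive_op_add pS1 pT1.
have rW : rlMW E (S1 + T1).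
  by apply: (rlMW_of_positive pW); apply: subspaceD (lMW_subspace E) _ _.
apply: (rlMW_order_convex rS rW (Uub S (or_introl erefl))).
apply: Umin; first exact: Lr_of_positive.
move=> _ [->|->]; rewrite ?SE ?TE.
  exact: op_le_trans (op_le_subr _ pS2) (op_le_addr _ pT1).
by rewrite [S1 + T1]addrC; apply: op_le_trans (op_le_subr _ pT2) (op_le_addr _ pS1).
Qed.

Lemma modulus_positive T M : is_modulus T M -> positive_op M.
Proof.
move=> [_ Mub _].
exact: positive_op_of_bounds (Mub T (or_introl erefl)) (Mub (- T) (or_intror erefl)).
Qed.

Lemma modulus_rlMW T M : rlMW E T -> is_modulus T M -> rlMW E M.
Proof.
by move=> rT; apply: rlMW_sup => //; apply: subspaceN (rlMW_subspace E) rT.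
Qed.

Lemma op_norm_ub V x : positive_op V -> `|x| <= 1 -> `|V x| <= op_norm V.
Proof.
move=> pV x1; have [K K0 hK] := @positive_map_bounded _ E E V pV.
apply: ub_le_sup; last by exists x.
exists K => _ [y y1 <-]; apply: le_trans (hK y) _.
by rewrite -[leRHS]mulr1 ler_pM2l.
Qed.

Lemma norm_op_norm_le V x : positive_op V -> `|V x| <= op_norm V * `|x|.
Proof.
move=> pV; have [lV _] := pV; have [->|x0] := eqVneq x 0.
  by rewrite (linear_map0 lV) !normr0 mulr0.
have nx : 0 < `|x| by rewrite normr_gt0.
rewrite -ler_pdivrMr // mulrC -[`|x|^-1]ger0_norm ?invr_ge0 //.
rewrite -normrZ -(linear_mapZ lV); apply: op_norm_ub => //.
by rewrite normrZ ger0_norm ?invr_ge0 // mulVf // gt_eqF.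
Qed.

(** For positive operators it suffices to test the norm on positive vectors,
    since [|S x| <= S |x|] and [x], [|x|] have the same norm. *)
Lemma op_norm_le S T : positive_op S -> positive_op T -> op_le S T ->
  op_norm S <= op_norm T.
Proof.
move=> pS pT ST; apply: ge_sup; first by exists `|S 0|, 0 => //=; rewrite normr0.
move=> _ [x /= x1 <-].
apply: le_trans (@norm_positive_map_le _ E E S x pS) _.
have x0 := vabs_ge0 x; have [_ posS] := pS.
apply: le_trans (norm_le_ge0 (posS _ x0) (op_le_vle ST x0)) _.
by apply: op_norm_ub; rewrite ?norm_vabs.
Qed.

(** Take an r-l-MW operator [S = S1 - S2] and a positive [V] of small norm with
    [- V <= T - S <= V].  Then [T <= S1 + V], hence [T^+ <= S1 + V], and
    likewise [T^- <= S2 + V]; both parts of [T] are l-MW by approximation. *)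
Lemma rlMW_closed : dedekind_complete E -> closed_in_Lr (rlMW E).
Proof.
move=> dE T LT Tapprox.
have [U [LU Uub Umin]] := Lr_sup dE LT (Lr_of_positive (positive_op0 E)).
have TU : op_le T U by apply: Uub; left.
have pU : positive_op U by have := Uub 0 (or_intror erefl); rewrite /op_le subr0.
have approx (e : R) : 0 < e -> exists S V, [/\ rlMW E S, positive_op V,
    forall x, `|V x| <= e * `|x|, op_le (T - S) V & op_le (- (T - S)) V].
  move=> /Tapprox [S rS] /inf_lt [].
    have [D [_ TD NTD]] := Lr_bounded (subspaceB (Lr_subspace E) LT (rlMW_Lr rS)).
    by exists (op_norm D), D.
  move=> _ [V [h1 h2] <-] /ltW Ve; have pV := positive_op_of_bounds h1 h2.
  exists S, V; split=> // x; apply: le_trans (norm_op_norm_le _ pV) _.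
  exact: ler_wpM2r.
(* [U] is the positive part of [T], and [U - T] the negative part. *)
exists U, (U - T); split; last by rewrite opprB addrC subrK.
  split=> //; apply: lMW_approx => // e /approx [S [V [rS pV Ve h1 h2]]].
  have [S1 [S2 [[p1 l1] [p2 l2] SE]]] := rS.
  exists S1, V; split => //; apply: Umin; first exact/Lr_of_positive/positive_op_add.
  move=> _ [->|->]; last by rewrite /op_le subr0; apply: positive_op_add.
  rewrite -[T](subrK S) addrC; apply: op_le_add => //.
  by rewrite SE; apply: op_le_subr.
split=> //; apply: lMW_approx => // e /approx [S [V [rS pV Ve h1 h2]]].
have [S1 [S2 [[p1 l1] [p2 l2] SE]]] := rS.
exists S2, V; split => //.
(* [U - T <= S2 + V] amounts to [U <= S2 + V + T], and the right-hand side is an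
   upper bound of [T] and of 0. *)
rewrite /op_le opprB addrA; apply: Umin.
  apply: subspaceD (Lr_subspace E) _ LT; exact/Lr_of_positive/positive_op_add.
move=> _ [->|->]; first by rewrite /op_le addrK; apply: positive_op_add.
rewrite /op_le subr0 (_ : _ + T = V - (- (T - S)) + S1); first exact: positive_op_add.
by rewrite SE opprK opprB -!addrA addNr addr0 [T + S2]addrC [RHS]addrCA.
Qed.

(** The modulus of [T] is the least operator above [T] and [- T], and it is
    l-MW, so its norm is the minimum of both sets whose infima are compared. *)
Lemma rlMW_norm_eq T : dedekind_complete E -> rlMW E T -> rlMW_norm T = reg_norm T.
Proof.
move=> dE rT; have LT := rlMW_Lr rT.
have [M Mmod] := Lr_sup dE LT (subspaceN (Lr_subspace E) LT).
have pM := modulus_positive Mmod; have lM := lMW_of_rlMW (modulus_rlMW rT Mmod).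
have [_ Mub Mmin] := Mmod.
have h1 := Mub _ (or_introl erefl); have h2 := Mub _ (or_intror erefl).
have lb S : op_le T S -> op_le (- T) S -> op_norm M <= op_norm S.
  move=> s1 s2; have pS := positive_op_of_bounds s1 s2.
  by apply: op_norm_le => //; apply: Mmin; [exact: Lr_of_positive | move=> _ [->|->]].
have infM (A : set (E -> E)) : A M -> (forall S, A S -> op_norm M <= op_norm S) ->
    inf [set op_norm S | S in A] = op_norm M.
  move=> AM Alb; apply/le_anti/andP; split.
    by apply: ge_inf; [exists (op_norm M) => _ [S AS <-]; apply: Alb | exists M].
  by apply: lb_le_inf; [exists (op_norm M), M | move=> _ [S AS <-]; apply: Alb].
rewrite /rlMW_norm /reg_norm !infM //.
  by move=> S [s1 s2]; apply: lb.
by move=> S [s1 s2 _]; apply: lb.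
Qed.

Lemma rlMW_order_ideal : order_ideal_of_Lr (rlMW E).
Proof.
split; [exact: rlMW_Lr | exact: rlMW_subspace|].
move=> S T MS MT LS rT mS /(modulus_rlMW rT) rMT ST; have [_ Sub _] := mS.
apply: (@rlMW_order_convex (- MT) MT) => //.
- exact: subspaceN (rlMW_subspace E) rMT.
- by apply/op_le_oppl; apply: op_le_trans ST; apply: Sub; right.
by apply: op_le_trans ST; apply: Sub; left.
Qed.

Lemma rlMW_sublattice : dedekind_complete E -> sublattice_of_Lr (rlMW E).
Proof.
move=> dE; split; [exact: rlMW_Lr | exact: rlMW_subspace|].
move=> S T rS rT; have [LS LT] := (rlMW_Lr rS, rlMW_Lr rT).
have [U supU] := Lr_sup dE LS LT; have rU := rlMW_sup rS rT supU.
split; first by exists U.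
exists (S + T - U); first exact: inf_of_sup.
by apply: subspaceB (rlMW_subspace E) _ rU; apply: subspaceD (rlMW_subspace E) rS rT.
Qed.

Lemma rlMW_subalgebra : subalgebra_of_Lr (rlMW E).
Proof.
split; [exact: rlMW_Lr | exact: rlMW_subspace | move=> S T rS rT].
exact: rlMW_comp (rlMW_Lr rS) rT.
Qed.

(** A left ideal containing the identity is everything. *)
Lemma rlMW_eq_Lr : rlMW E = Lr E <-> lMW E (fun x => x).
Proof.
split=> [eqL|lid].
  by apply: lMW_of_rlMW; rewrite eqL; apply: Lr_of_positive; split.
apply/seteqP; split; first exact: rlMW_Lr.
by move=> T LT; apply: (rlMW_comp LT); apply: rlMW_of_positive => //; split.
Qed.

End OrderStructure.

Theorem theorem2p9p4 (R : realType) (E : banachLatticeType R) :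
  (subalgebra_of_Lr (rlMW E) /\
   (rlMW E = Lr E <-> lMW E (fun x => x))) /\
  (dedekind_complete E ->
     [/\ Riesz_subalgebra_of_Lr (rlMW E),
         order_ideal_of_Lr (rlMW E),
         closed_in_Lr (rlMW E) &
         forall T : E -> E, rlMW E T -> rlMW_norm T = reg_norm T]).
Proof.
split; first by split; [exact: rlMW_subalgebra | exact: rlMW_eq_Lr].
move=> dE; split.
- by split; [exact: rlMW_subalgebra | exact: rlMW_sublattice].
- exact: rlMW_order_ideal.
- exact: rlMW_closed.
by move=> T; exact: rlMW_norm_eq.
Qed.
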